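(* Let $0<\alpha<1$. Let $\varphi$ be a holomorphic self-map of the unit disk $\mathbb{D}$ with $\varphi(0)=0$ and $0<|\varphi'(0)|<1$, and let $\sigma$ be the Königs function of $\varphi$. Suppose that the composition operator $C_\varphi$ is bounded on $\mathcal{B}_\alpha$ and that there exists a non-negative integer $m$ such that $$\frac{(1-|\varphi_m(z)|^2)^\alpha\,|\varphi'(\varphi_m(z))|}{(1-|\varphi_{m+1}(z)|^2)^\alpha}\le |\varphi'(0)|\qquad\text{for all } z\in\mathbb{D}.$$ Then $\sigma^n\in\mathcal{B}_\alpha$ for all positive integers $n$.
   Context: $\mathbb{D}$ is the open unit disk in the complex plane. For $\alpha>0$, the Bloch-type space $\mathcal{B}_\alpha$ is the set of holomorphic $f$ on $\mathbb{D}$ with $\sup_{z\in\mathbb{D}}(1-|z|^2)^\alpha|f'(z)|<\infty$; it is a Banach space under the norm $\|f\|_{\mathcal{B}_\alpha}=|f(0)|+\sup_{z\in\mathbb{D}}(1-|z|^2)^\alpha|f'(z)|$. The composition operator is $C_\varphi f=f\circ\varphi$. $\varphi_k$ denotes the $k$-th iterate of $\varphi$ (with $\varphi_0(z)=z$). When $\varphi(0)=0$ and $0<|\varphi'(0)|<1$, the Königs function $\sigma$ of $\varphi$ is the holomorphic function $\sigma=\lim_{k\to\infty}\varphi_k/\varphi'(0)^k$ (the limit exists uniformly on compact subsets of $\mathbb{D}$ by Königs's theorem); it satisfies $\sigma\circ\varphi=\varphi'(0)\sigma$. $\sigma^n$ denotes the $n$-th pointwise power of $\sigma$. *)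

(* Defs.v *)
From Stdlib Require Import Reals.
From Coquelicot Require Import Coquelicot.
Open Scope R_scope.

(* Functions on the open unit disk are represented by total functions [C -> C];
   the notions below depend only on their values on the disk. *)
Definition in_disk (z : C) : Prop := Cmod z < 1.

Definition holomorphic_on_disk (f : C -> C) : Prop :=
  forall z : C, in_disk z -> ex_derive (K := C_AbsRing) (V := C_NormedModule) f z.

Definition self_map_disk (phi : C -> C) : Prop :=
  holomorphic_on_disk phi /\ (forall z : C, in_disk z -> in_disk (phi z)).

Definition weight (alpha : R) (z : C) : R := Rpower (1 - Cmod z ^ 2) alpha.

Definition Bloch (alpha : R) (f : C -> C) : Prop :=
  holomorphic_on_disk f /\
  exists M : R, forall z : C, in_disk z -> weight alpha z * Cmod (C_derive f z) <= M.

(* [Lub_Rbar] takes values in [Rbar]; it is finite here whenever [Bloch alpha f]. *)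
Definition Bloch_norm (alpha : R) (f : C -> C) : R :=
  Cmod (f (RtoC 0)) +
  real (Lub_Rbar (fun y : R => exists z : C,
    in_disk z /\ y = weight alpha z * Cmod (C_derive f z))).

Definition comp_op (phi f : C -> C) : C -> C := fun z => f (phi z).

Definition comp_op_bounded (alpha : R) (phi : C -> C) : Prop :=
  exists M : R, forall f : C -> C, Bloch alpha f ->
    Bloch alpha (comp_op phi f) /\
    Bloch_norm alpha (comp_op phi f) <= M * Bloch_norm alpha f.

Definition iterate (phi : C -> C) (k : nat) (z : C) : C := Nat.iter k phi z.

(* Pointwise convergence to a holomorphic function determines [sigma] on the disk;
   convergence uniform on compact subsets is then part of Koenigs's theorem and
   is not assumed. *)
Definition is_Koenigs (phi sigma : C -> C) : Prop :=
  holomorphic_on_disk sigma /\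
  forall z : C, in_disk z ->
    filterlim (fun k : nat => Cdiv (iterate phi k z) (Cpow (C_derive phi (RtoC 0)) k))
      eventually (locally (sigma z)).

(* Main.v *)
Require Import Defs.
From Stdlib Require Import Reals Lra Lia.
From Coquelicot Require Import Coquelicot.
Open Scope R_scope.

(** Write [lam = phi'(0)] and [w z = (1 - |z|^2)^alpha]. Testing boundedness of
    [C_phi] on the rational functions [bloch_kernel alpha a] with [a = phi z] gives
    [w z |phi' z| <= K w (phi z)], hence [w z |phi_m' z| <= K^m w (phi_m z)]. By the
    hypothesis on [phi_m], each further iteration costs only a factor [|lam|], so that
    [w z |(phi_k / lam^k)' z| <= (K / |lam|)^m] for all [k >= m]. This bound passes to the
    limit [sigma], up to a constant, because it makes the functions [phi_k / lam^k]
    equi-Lipschitz near [z]. Thus [sigma] is in [B_alpha]; since [alpha < 1] the weight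
    [1 / w] is integrable along radii, so [sigma] is bounded, and
    [(sigma^n)' = n sigma^(n-1) sigma'] concludes. *)

(** * Rules of complex differentiation *)

Local Notation is_derive_C := (is_derive (K := C_AbsRing) (V := C_NormedModule)).
Local Notation ex_derive_C := (ex_derive (K := C_AbsRing) (V := C_NormedModule)).

(** Linearity of $h \mapsto h l$ is automatic, so only the remainder estimate is left. The domain
    carries the uniform structure of the modulus, hence neighbourhoods of $z$ are disks and later
    proofs can work with explicit radii. *)
Lemma is_derive_C_eps (f : C -> C) (z l : C) :
  is_derive_C f z l <->
  forall eps : posreal, exists d : posreal, forall y : C, Cmod (y - z) < d ->
    Cmod (f y - f z - (y - z) * l) <= eps * Cmod (y - z).
Proof.
split.
- intros [_ H] eps.
  destruct (H z (fun P HP => HP) eps) as [d Hd].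
  exists d; intros y Hy; exact (Hd y Hy).
- intros H; split.
  + apply (is_linear_scal_l (K := C_AbsRing) (V := C_NormedModule) l).
  + intros x Hx eps.
    rewrite <- (is_filter_lim_locally_unique
      (K := C_AbsRing) (V := AbsRing_NormedModule C_AbsRing) _ _ Hx).
    destruct (H eps) as [d Hd].
    exists d; intros y Hy; exact (Hd y Hy).
Qed.

(* [C_NormedModule] carries the product uniform structure of [R * R], whereas the product and
   chain rules are stated for the uniform structure of the absolute value. *)
Lemma is_derive_C_iff_AbsRing (f : C -> C) (z l : C) :
  is_derive_C f z l <->
  is_derive (K := C_AbsRing) (V := AbsRing_NormedModule C_AbsRing) f z l.
Proof.
split; intros [[L1 L2 L3] H]; (split; [split; [exact L1|exact L2|exact L3]|exact H]).
Qed.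

Lemma is_derive_C_derive (f : C -> C) (z : C) :
  ex_derive_C f z ->
  is_derive_C f z (C_derive f z).
Proof. intros H; exact (C_derive_correct f z z H). Qed.

Lemma is_derive_C_comp (f g : C -> C) (z df dg : C) :
  is_derive_C f (g z) df ->
  is_derive_C g z dg ->
  is_derive_C (fun x => f (g x)) z (dg * df)%C.
Proof.
intros Hf Hg.
apply (is_derive_comp (K := C_AbsRing) (V := C_NormedModule) f g z df dg Hf).
now apply is_derive_C_iff_AbsRing.
Qed.

(** The exponent [S n] keeps truncated subtraction out of the derivative. *)
Lemma is_derive_C_pow (f : C -> C) (z l : C) (n : nat) :
  is_derive_C f z l ->
  is_derive_C
    (fun x => Cpow (f x) (S n)) z (RtoC (INR (S n)) * Cpow (f z) n * l)%C.
Proof.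
intros Hf; apply is_derive_C_iff_AbsRing in Hf; apply is_derive_C_iff_AbsRing.
induction n as [|n IH].
- apply (is_derive_ext (K := C_AbsRing) (V := AbsRing_NormedModule C_AbsRing) f).
  + intros t; simpl; symmetry; apply Cmult_1_r.
  + replace (RtoC (INR 1) * Cpow (f z) 0 * l)%C with l; [exact Hf|].
    simpl; ring.
- generalize (is_derive_mult (K := C_AbsRing) f (fun x => Cpow (f x) (S n)) z _ _ Hf IH Cmult_comm).
  intros H.
  match type of H with is_derive _ _ ?d =>
    replace (RtoC (INR (S (S n))) * Cpow (f z) (S n) * l)%C with d end; [exact H|].
  rewrite (S_INR (S n)), RtoC_plus.
  change (l * (f z * Cpow (f z) n) + f z * (RtoC (INR (S n)) * Cpow (f z) n * l) =
     (RtoC (INR (S n)) + RtoC 1) * (f z * Cpow (f z) n) * l)%C.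
  ring.
Qed.

(** * Mean value inequality along segments *)

(** For $u \ne 0$ the choice $c = \bar u/|u|$ gives $cu = |u|$. This reduces bounds on complex
    increments to real-valued functions. *)
Lemma Cmod_le_of_Re (u : C) (M : R) :
  0 <= M -> (forall c : C, Cmod c <= 1 -> Re (c * u)%C <= M) -> Cmod u <= M.
Proof.
intros HM H.
destruct (Req_dec (Cmod u) 0) as [E|E]; [lra|].
assert (Hp := Cmod_ge_0 u).
assert (Hu : u <> RtoC 0) by (intros E'; apply E; rewrite E'; apply Cmod_0).
assert (Hr : RtoC (Cmod u) <> RtoC 0) by (intros E'; apply E; now apply RtoC_inj).
specialize (H (Cconj u / RtoC (Cmod u))%C).
replace (Cconj u / RtoC (Cmod u) * u)%C with (RtoC (Cmod u)) in H.
- apply H. rewrite Cmod_div, Cmod_conj, Cmod_R, Rabs_pos_eq by assumption.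
  right; now field.
- replace (Cconj u / RtoC (Cmod u) * u)%C with (u * Cconj u / RtoC (Cmod u))%C
    by (now field).
  rewrite <- Cmod2_conj, RtoC_pow. simpl. now field.
Qed.

Lemma derivable_pt_lim_Re_line (f : C -> C) (c z v : C) (t : R) :
  ex_derive_C f (z + RtoC t * v)%C ->
  derivable_pt_lim (fun s => Re (c * f (z + RtoC s * v))%C) t
    (Re (c * (v * C_derive f (z + RtoC t * v)))%C).
Proof.
intros Hf eps Heps.
apply is_derive_C_derive in Hf.
set (w := (z + RtoC t * v)%C) in *; set (l := C_derive f w) in *.
assert (Hc := Cmod_ge_0 c); assert (Hv := Cmod_ge_0 v).
(* Adding 1 to both moduli keeps the denominators positive when $c$ or $v$ vanishes, and makes the
   final inequality strict. *)
assert (HA : 0 < eps / ((Cmod c + 1) * (Cmod v + 1))).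
{ apply Rdiv_lt_0_compat; [lra|apply Rmult_lt_0_compat; lra]. }
destruct (proj1 (is_derive_C_eps f w l) Hf (mkposreal _ HA)) as [d Hd].
assert (Hd' : 0 < d / (Cmod v + 1)) by (apply Rdiv_lt_0_compat; [apply cond_pos|lra]).
exists (mkposreal _ Hd'); intros h Hh0 Hh; simpl in Hh, Hd.
assert (Hhp := Rabs_pos_lt h Hh0).
assert (E : ((z + RtoC (t + h) * v) - w = RtoC h * v)%C).
{ unfold w; rewrite RtoC_plus; ring. }
specialize (Hd (z + RtoC (t + h) * v)%C); rewrite E, Cmod_mult, Cmod_R in Hd.
assert (Hlt : Rabs h * Cmod v < d).
{ apply Rle_lt_trans with (Rabs h * (Cmod v + 1)); [nra|].
  apply (Rmult_lt_compat_r (Cmod v + 1)) in Hh; [|lra].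
  unfold Rdiv in Hh; rewrite Rmult_assoc, Rinv_l, Rmult_1_r in Hh; lra. }
specialize (Hd Hlt).
set (q := (f (z + RtoC (t + h) * v) - f w - RtoC h * v * l)%C) in Hd.
(* The error of the real difference quotient is exactly $\mathrm{Re}(cq)/h$, where $q$ is the
   complex remainder. *)
replace ((Re (c * f (z + RtoC (t + h) * v))%C - Re (c * f w)%C) / h - Re (c * (v * l))%C)
  with (Re (c * q)%C / h).
2:{ unfold q. rewrite <- (Rmult_1_r (Re (c * (v * l))%C)).
  replace 1 with (h / h) by now field.
  unfold Cminus. rewrite !Cmult_plus_distr_l. unfold Rdiv.
  simpl. field; assumption. }
unfold Rdiv; rewrite Rabs_mult, Rabs_inv.
apply (Rmult_lt_reg_r (Rabs h)); [assumption|].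
rewrite Rmult_assoc, Rinv_l, Rmult_1_r by lra.
apply Rle_lt_trans with (Cmod c * Cmod q).
{ rewrite <- Cmod_mult; apply re_le_Cmod. }
apply Rle_lt_trans with
  (Cmod c * (eps / ((Cmod c + 1) * (Cmod v + 1)) * (Rabs h * Cmod v))).
{ apply Rmult_le_compat_l; assumption. }
replace (Cmod c * (eps / ((Cmod c + 1) * (Cmod v + 1)) * (Rabs h * Cmod v)))
  with (eps * Rabs h * ((Cmod c * Cmod v) / ((Cmod c + 1) * (Cmod v + 1)))) by (field; lra).
rewrite <- (Rmult_1_r (eps * Rabs h)) at 2.
apply Rmult_lt_compat_l; [nra|].
apply (Rmult_lt_reg_r ((Cmod c + 1) * (Cmod v + 1))); [nra|].
unfold Rdiv; rewrite Rmult_assoc, Rinv_l; nra.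
Qed.

(** The real mean value theorem applies to $t \mapsto G(t) - \mathrm{Re}(c f(z+tv))$, whose
    derivative is nonnegative for every $|c| \le 1$. A general majorant $G$ serves both Lipschitz
    bounds ($G$ linear) and integration of the singular weight along a radius. *)
Lemma Cmod_mean_value (f : C -> C) (z v : C) (G dG : R -> R) :
  (forall t, 0 <= t <= 1 ->
    ex_derive_C f (z + RtoC t * v)%C) ->
  (forall t, 0 <= t <= 1 -> derivable_pt_lim G t (dG t)) ->
  (forall t, 0 <= t <= 1 -> Cmod v * Cmod (C_derive f (z + RtoC t * v)%C) <= dG t) ->
  Cmod (f (z + v)%C - f z)%C <= G 1 - G 0.
Proof.
intros Hf HG Hle.
assert (Hmv : forall c, Cmod c <= 1 -> Re (c * (f (z + v)%C - f z))%C <= G 1 - G 0).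
{ intros c Hc.
  destruct (MVT_cor2 (fun t => G t - Re (c * f (z + RtoC t * v))%C)
    (fun t => dG t - Re (c * (v * C_derive f (z + RtoC t * v)))%C) 0 1) as [t [Ht Ht01]].
  - lra.
  - intros t Ht. apply derivable_pt_lim_minus; [now apply HG|].
    apply derivable_pt_lim_Re_line; now apply Hf.
  - assert (Ht' : 0 <= t <= 1) by lra.
    specialize (Hle t Ht').
    assert (Hre : Re (c * (v * C_derive f (z + RtoC t * v)))%C <= dG t).
    { eapply Rle_trans; [apply Rle_abs|]. eapply Rle_trans; [apply re_le_Cmod|].
      rewrite !Cmod_mult.
      assert (H0 := Cmod_ge_0 v); assert (H1 := Cmod_ge_0 (C_derive f (z + RtoC t * v))).
      assert (H2 := Rmult_le_pos _ _ H0 H1). nra. }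
    replace (z + RtoC 1 * v)%C with (z + v)%C in Ht by ring.
    replace (z + RtoC 0 * v)%C with z in Ht by ring.
    unfold Cminus; rewrite Cmult_plus_distr_l.
    replace (Re (c * f (z + v) + c * - f z)%C)
      with (Re (c * f (z + v))%C - Re (c * f z)%C) by (simpl; ring).
    nra. }
apply Cmod_le_of_Re; [|exact Hmv].
(* The case $c = 0$ yields the required $0 \le G(1) - G(0)$. *)
generalize (Hmv (RtoC 0)); rewrite Cmod_0, Cmult_0_l; simpl; lra.
Qed.

Lemma Cmod_derive_le_of_Lipschitz (f : C -> C) (z l : C) (d L : R) :
  0 < d ->
  (forall y, Cmod (y - z) < d -> Cmod (f y - f z) <= L * Cmod (y - z)) ->
  is_derive_C f z l ->
  Cmod l <= L.
Proof.
intros Hd HL Hl; apply le_epsilon; intros eps Heps.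
destruct (proj1 (is_derive_C_eps f z l) Hl (mkposreal _ Heps)) as [d' Hd'].
(* One real increment, small enough for both the Lipschitz bound and the derivative estimate,
   suffices to bound $|l|$ by $L + \varepsilon$. *)
set (h := Rmin d d' / 2).
assert (Hh : 0 < h < d /\ h < d').
{ unfold h; generalize (cond_pos d') (Rmin_l d d') (Rmin_r d d'); intros.
  assert (0 < Rmin d d') by (now apply Rmin_pos). lra. }
specialize (HL (z + RtoC h)%C); specialize (Hd' (z + RtoC h)%C).
replace (z + RtoC h - z)%C with (RtoC h) in HL, Hd' by ring.
rewrite Cmod_R, Rabs_pos_eq in HL, Hd' by lra.
simpl in Hd'; specialize (HL ltac:(lra)); specialize (Hd' ltac:(lra)).
assert (H : h * Cmod l <= (L + eps) * h).
{ replace (h * Cmod l) with (Cmod (RtoC h * l)%C)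
    by (rewrite Cmod_mult, Cmod_R, Rabs_pos_eq; lra).
  replace (RtoC h * l)%C with
    ((f (z + RtoC h) - f z) + - (f (z + RtoC h) - f z - RtoC h * l))%C by ring.
  eapply Rle_trans; [apply Cmod_triangle|]; rewrite Cmod_opp; lra. }
apply (Rmult_le_reg_l h); lra.
Qed.

(** * The weight and the Bloch norm *)

Lemma Rpower_1_l (x : R) : Rpower 1 x = 1.
Proof. unfold Rpower; rewrite ln_1, Rmult_0_r; apply exp_0. Qed.

Lemma one_minus_Cmod_sq_bounds (z : C) :
  in_disk z -> 1 - Cmod z <= 1 - Cmod z ^ 2 <= 1 /\ 1 - Cmod z ^ 2 <= 2 * (1 - Cmod z).
Proof. unfold in_disk; intros Hz; assert (H := Cmod_ge_0 z); nra. Qed.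

Lemma weight_pos (alpha : R) (z : C) : 0 < weight alpha z.
Proof. apply exp_pos. Qed.

Lemma weight_le_1 (alpha : R) (z : C) : 0 <= alpha -> in_disk z -> weight alpha z <= 1.
Proof.
intros Ha Hz; destruct (one_minus_Cmod_sq_bounds z Hz) as [H _].
unfold in_disk in Hz.
rewrite <- (Rpower_1_l alpha).
apply Rle_Rpower_l; lra.
Qed.

Lemma Bloch_norm_ge (alpha : R) (f : C -> C) (z : C) :
  Bloch alpha f -> in_disk z -> weight alpha z * Cmod (C_derive f z) <= Bloch_norm alpha f.
Proof.
intros [_ [M HM]] Hz; unfold Bloch_norm.
assert (H0 := Cmod_ge_0 (f (RtoC 0))).
match goal with |- context [Lub_Rbar ?S] => set (E := S) end.
destruct (Lub_Rbar_correct E) as [Hub Hlub].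
assert (HzE : E (weight alpha z * Cmod (C_derive f z))) by (now exists z).
specialize (Hub _ HzE).
assert (HM' : Rbar_le (Lub_Rbar E) M).
{ apply Hlub; intros y [w [Hw ->]]; now apply HM. }
(* [real] would send an infinite supremum to 0; the member [HzE] excludes $-\infty$ and the bound
   [M] excludes $+\infty$. *)
destruct (Lub_Rbar E) as [l| |]; simpl in *; try tauto; lra.
Qed.

Lemma Bloch_norm_le (alpha : R) (f : C -> C) (M : R) :
  (forall z, in_disk z -> weight alpha z * Cmod (C_derive f z) <= M) ->
  Bloch_norm alpha f <= Cmod (f (RtoC 0)) + M.
Proof.
intros HM; unfold Bloch_norm; apply Rplus_le_compat_l.
match goal with |- context [Lub_Rbar ?S] => set (E := S) end.
destruct (Lub_Rbar_correct E) as [Hub Hlub].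
assert (H0 : in_disk (RtoC 0)) by (unfold in_disk; rewrite Cmod_0; lra).
assert (HzE : E (weight alpha (RtoC 0) * Cmod (C_derive f (RtoC 0)))) by (now exists (RtoC 0)).
specialize (Hub _ HzE).
assert (HM' : Rbar_le (Lub_Rbar E) M).
{ apply Hlub; intros y [w [Hw ->]]; now apply HM. }
destruct (Lub_Rbar E) as [l| |]; simpl in *; tauto.
Qed.

(** * Test functions and the weighted bound on $\varphi'$ *)

(** Both bounds pass through $1 - |a||u|$, which the triangle inequality puts below $|1 - \bar a
    u|$. *)
Lemma Cmod_one_minus_conj_mult_ge (a u : C) :
  in_disk a -> in_disk u ->
  1 - Cmod a <= Cmod (1 - Cconj a * u) /\ 1 - Cmod u <= Cmod (1 - Cconj a * u).
Proof.
unfold in_disk; intros Ha Hu.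
assert (H : 1 - Cmod a * Cmod u <= Cmod (1 - Cconj a * u)).
{ rewrite <- (Cmod_conj a), <- Cmod_mult.
  generalize (Cmod_triangle (1 - Cconj a * u) (Cconj a * u)).
  replace (1 - Cconj a * u + Cconj a * u)%C with (RtoC 1) by ring.
  rewrite Cmod_1; lra. }
assert (H0 := Cmod_ge_0 a); assert (H1 := Cmod_ge_0 u); nra.
Qed.

(* The derivative [(1 - |a|^2)^(2 - alpha) / (1 - conj a * u)^2] has weighted modulus at most 4
   on the disk and modulus exactly [1 / w a] at [u = a]. *)
Definition bloch_kernel (alpha : R) (a u : C) : C :=
  (RtoC (Rpower (1 - Cmod a ^ 2) (2 - alpha)) * u / (1 - Cconj a * u))%C.

Lemma one_minus_conj_mult_neq_0 (a u : C) :
  in_disk a -> in_disk u -> (1 - Cconj a * u)%C <> RtoC 0.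
Proof.
intros Ha Hu; apply Cmod_gt_0.
destruct (Cmod_one_minus_conj_mult_ge a u Ha Hu); unfold in_disk in Ha; lra.
Qed.

Lemma is_derive_bloch_kernel (alpha : R) (a z : C) :
  in_disk a -> in_disk z ->
  is_derive_C (bloch_kernel alpha a) z
    (RtoC (Rpower (1 - Cmod a ^ 2) (2 - alpha)) / ((1 - Cconj a * z) * (1 - Cconj a * z)))%C.
Proof.
intros Ha Hz; apply is_derive_C_eps; intros eps.
set (s := Rpower (1 - Cmod a ^ 2) (2 - alpha)).
assert (Hs : 0 < s) by apply exp_pos.
assert (Ha1 : 0 < 1 - Cmod a) by (unfold in_disk in Ha; lra).
assert (Hz1 : 0 < 1 - Cmod z) by (unfold in_disk in Hz; lra).
assert (Ha0 := Cmod_ge_0 a).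
set (k := 1 - Cmod a) in *.
assert (Hk3 : 0 < k ^ 3) by now apply pow_lt.
(* The exact remainder is $(y-z)^2 s\bar a / ((1-\bar a y)(1-\bar a z)^2)$, of modulus at most
   $s|y-z|^2/k^3$; hence this radius. The other radius keeps $y$ in the disk. *)
assert (Hd1 : 0 < eps * k ^ 3 / s).
{ apply Rdiv_lt_0_compat; [apply Rmult_lt_0_compat; [apply cond_pos|]|]; assumption. }
exists (mkposreal _ (Rmin_pos _ _ Hz1 Hd1)); simpl; intros y Hy.
assert (Hyz : Cmod (y - z) < 1 - Cmod z) by (eapply Rlt_le_trans; [exact Hy|apply Rmin_l]).
assert (Hye : Cmod (y - z) <= eps * k ^ 3 / s)
  by (left; eapply Rlt_le_trans; [exact Hy|apply Rmin_r]).
assert (Hyd : in_disk y).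
{ unfold in_disk; replace y with ((y - z) + z)%C by ring.
  eapply Rle_lt_trans; [apply Cmod_triangle|lra]. }
assert (Hy0 := one_minus_conj_mult_neq_0 a y Ha Hyd).
assert (Hz0 := one_minus_conj_mult_neq_0 a z Ha Hz).
destruct (Cmod_one_minus_conj_mult_ge a y Ha Hyd) as [Hy' _].
destruct (Cmod_one_minus_conj_mult_ge a z Ha Hz) as [Hz' _].
unfold bloch_kernel; fold s.
replace (RtoC s * y / (1 - Cconj a * y) - RtoC s * z / (1 - Cconj a * z) -
   (y - z) * (RtoC s / ((1 - Cconj a * z) * (1 - Cconj a * z))))%C
with ((y - z) * ((y - z) * (RtoC s * Cconj a) /
   ((1 - Cconj a * y) * ((1 - Cconj a * z) * (1 - Cconj a * z)))))%C
  by (now field).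
rewrite Cmod_mult, Rmult_comm; apply Rmult_le_compat_r; [apply Cmod_ge_0|].
rewrite Cmod_div by (repeat apply Cmult_neq_0; assumption).
rewrite !Cmod_mult, Cmod_conj, Cmod_R, Rabs_pos_eq by lra.
fold k in Hy', Hz'.
set (A := Cmod (1 - Cconj a * y)) in *; set (B := Cmod (1 - Cconj a * z)) in *.
assert (HAB : k ^ 3 <= A * (B * B)).
{ replace (k ^ 3) with (k * (k * k)) by ring.
  apply Rmult_le_compat; try nra. }
assert (HAB0 : 0 < A * (B * B)) by lra.
apply (Rmult_le_reg_r (A * (B * B))); [assumption|].
unfold Rdiv; rewrite Rmult_assoc, Rinv_l, Rmult_1_r by lra.
apply Rle_trans with (eps * k ^ 3).
- apply (Rmult_le_compat_r s) in Hye; [|lra].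
  unfold Rdiv in Hye; rewrite Rmult_assoc, Rinv_l, Rmult_1_r in Hye by lra.
  assert (Ha1' : Cmod a <= 1) by (unfold k in Ha1; lra).
  assert (H := Rmult_le_pos _ _ (Cmod_ge_0 (y - z)) (Rlt_le _ _ Hs)). nra.
- apply Rmult_le_compat_l; [left; apply cond_pos|assumption].
Qed.

Lemma C_derive_bloch_kernel_Cmod (alpha : R) (a z : C) :
  in_disk a -> in_disk z ->
  Cmod (C_derive (bloch_kernel alpha a) z) =
  Rpower (1 - Cmod a ^ 2) (2 - alpha) / Cmod (1 - Cconj a * z) ^ 2.
Proof.
intros Ha Hz.
rewrite (is_C_derive_unique _ _ _ (is_derive_bloch_kernel alpha a z Ha Hz)).
assert (Hz0 := one_minus_conj_mult_neq_0 a z Ha Hz).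
rewrite Cmod_div by (now apply Cmult_neq_0).
rewrite Cmod_mult, Cmod_R, Rabs_pos_eq by (left; apply exp_pos).
f_equal; ring.
Qed.

(** Both $1-|z|^2$ and $1-|a|^2$ are at most $2|1-\bar a z|$. Their exponents $\alpha$ and
    $2-\alpha$ are nonnegative and add up to 2, which gives the constant $2^2$. *)
Lemma bloch_kernel_bound (alpha : R) (a z : C) :
  0 < alpha < 1 -> in_disk a -> in_disk z ->
  weight alpha z * Cmod (C_derive (bloch_kernel alpha a) z) <= 4.
Proof.
intros Hal Ha Hz; rewrite C_derive_bloch_kernel_Cmod by assumption.
destruct (Cmod_one_minus_conj_mult_ge a z Ha Hz) as [Ha' Hz'].
destruct (one_minus_Cmod_sq_bounds a Ha) as [Ha1 Ha2].
destruct (one_minus_Cmod_sq_bounds z Hz) as [Hz1 Hz2].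
unfold in_disk in Ha, Hz; unfold weight.
set (D := Cmod (1 - Cconj a * z)) in *.
assert (HD : 0 < D) by lra.
apply (Rmult_le_reg_r (D ^ 2)); [now apply pow_lt|].
replace (Rpower (1 - Cmod z ^ 2) alpha *
  (Rpower (1 - Cmod a ^ 2) (2 - alpha) / D ^ 2) * D ^ 2)
  with (Rpower (1 - Cmod z ^ 2) alpha * Rpower (1 - Cmod a ^ 2) (2 - alpha)) by (field; lra).
replace (4 * D ^ 2) with (Rpower (2 * D) alpha * Rpower (2 * D) (2 - alpha)).
- apply Rmult_le_compat; try (left; apply exp_pos); apply Rle_Rpower_l; lra.
- rewrite <- Rpower_plus. replace (alpha + (2 - alpha)) with (INR 2) by (simpl; ring).
  rewrite Rpower_pow by lra. ring.
Qed.

Lemma C_derive_bloch_kernel_diag (alpha : R) (a : C) :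
  in_disk a -> Cmod (C_derive (bloch_kernel alpha a) a) = / weight alpha a.
Proof.
intros Ha; rewrite C_derive_bloch_kernel_Cmod by assumption.
destruct (one_minus_Cmod_sq_bounds a Ha) as [Ha1 _]; unfold in_disk in Ha.
replace (1 - Cconj a * a)%C with (RtoC (1 - Cmod a ^ 2)).
- rewrite Cmod_R, Rabs_pos_eq by lra. unfold weight.
  rewrite <- Rpower_Ropp, <- (Rpower_pow 2 (1 - Cmod a ^ 2)) by lra.
  unfold Rdiv; rewrite <- Rpower_Ropp, <- Rpower_plus; f_equal; simpl; ring.
- rewrite RtoC_minus, Cmod2_conj; ring.
Qed.

Lemma comp_op_bounded_weight (alpha : R) (phi : C -> C) :
  0 < alpha < 1 -> self_map_disk phi -> comp_op_bounded alpha phi ->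
  exists K : R, 0 <= K /\ forall z, in_disk z ->
    weight alpha z * Cmod (C_derive phi z) <= K * weight alpha (phi z).
Proof.
intros Hal [Hphi Hself] [M HM].
(* The kernels vanish at 0, so their norms are at most 4 uniformly in $a$. The absolute value is
   there because the sign of [M] is not given. *)
exists (Rabs M * 4); split; [generalize (Rabs_pos M); lra|].
intros z Hz; set (a := phi z).
assert (Ha : in_disk a) by now apply Hself.
assert (HB : Bloch alpha (bloch_kernel alpha a)).
{ split.
  - intros u Hu; eexists; now apply is_derive_bloch_kernel.
  - exists 4; intros u Hu; now apply bloch_kernel_bound. }
destruct (HM _ HB) as [HB' Hle].
assert (H4 : Bloch_norm alpha (bloch_kernel alpha a) <= 4).
{ eapply Rle_trans.
  - apply Bloch_norm_le; intros u Hu; now apply bloch_kernel_bound.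
  - replace (bloch_kernel alpha a (RtoC 0)) with (RtoC 0); [rewrite Cmod_0; lra|].
    unfold bloch_kernel, Cdiv; ring. }
assert (H0 : 0 <= Bloch_norm alpha (bloch_kernel alpha a)).
{ eapply Rle_trans; [|apply (Bloch_norm_ge alpha _ a HB Ha)].
  apply Rmult_le_pos; [left; apply weight_pos|apply Cmod_ge_0]. }
assert (Hz' := Bloch_norm_ge alpha _ z HB' Hz).
assert (Hd : C_derive (comp_op phi (bloch_kernel alpha a)) z =
  (C_derive phi z * C_derive (bloch_kernel alpha a) a)%C).
{ apply is_C_derive_unique, (is_derive_C_comp (bloch_kernel alpha a) phi).
  - apply is_derive_C_derive; eexists; now apply is_derive_bloch_kernel.
  - now apply is_derive_C_derive, Hphi. }
rewrite Hd, Cmod_mult, C_derive_bloch_kernel_diag in Hz' by assumption.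
assert (Hw := weight_pos alpha a).
assert (HMle : M * Bloch_norm alpha (bloch_kernel alpha a) <= Rabs M * 4).
{ apply Rle_trans with (Rabs M * Bloch_norm alpha (bloch_kernel alpha a)).
  - apply Rmult_le_compat_r; [assumption|apply Rle_abs].
  - apply Rmult_le_compat_l; [apply Rabs_pos|assumption]. }
apply (Rmult_le_reg_r (/ weight alpha a)); [now apply Rinv_0_lt_compat|].
rewrite (Rmult_assoc (Rabs M * 4)), Rinv_r, Rmult_1_r, Rmult_assoc by lra.
eapply Rle_trans; [exact Hz'|].
eapply Rle_trans; [exact Hle|exact HMle].
Qed.

(** * Weighted derivatives of the iterates *)

Lemma iterate_in_disk (phi : C -> C) (k : nat) (z : C) :
  self_map_disk phi -> in_disk z -> in_disk (iterate phi k z).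
Proof. intros [_ H] Hz; induction k as [|k IH]; simpl; auto. Qed.

(** Peeling off the outermost copy of $\varphi$ leaves the factor $\varphi'(\varphi_k(z))$, the kind
    of factor that the weighted estimates control. *)
Lemma is_derive_iterate (phi : C -> C) (k : nat) (z : C) :
  self_map_disk phi -> in_disk z ->
  ex_derive_C (iterate phi k) z /\
  C_derive (iterate phi (S k)) z =
    (C_derive (iterate phi k) z * C_derive phi (iterate phi k z))%C.
Proof.
intros Hphi Hz.
assert (Hstep : forall k,
  ex_derive_C (iterate phi k) z ->
  is_derive_C (iterate phi (S k)) z
    (C_derive (iterate phi k) z * C_derive phi (iterate phi k z))%C).
{ intros j Hj; apply (is_derive_C_comp phi (iterate phi j)).
  - apply is_derive_C_derive, Hphi; now apply iterate_in_disk.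
  - now apply is_derive_C_derive. }
assert (Hex : ex_derive_C (iterate phi k) z).
{ induction k as [|k IH].
  - exists (RtoC 1). apply is_derive_C_iff_AbsRing.
    apply (is_derive_id (K := C_AbsRing)).
  - eexists; now apply Hstep. }
split; [exact Hex|]. now apply is_C_derive_unique, Hstep.
Qed.

Lemma iterate_add (phi : C -> C) (j k : nat) (z : C) :
  iterate phi (j + k) z = iterate phi j (iterate phi k z).
Proof. apply Nat.iter_add. Qed.

(** With $w$ the weight, the ratios $w(\varphi_i)|\varphi'(\varphi_i)|/w(\varphi_{i+1})$ are at most
    $K$, and their product telescopes. *)
Lemma weight_C_derive_iterate_le (alpha K : R) (phi : C -> C) (k : nat) (z : C) :
  0 <= K -> self_map_disk phi ->
  (forall z, in_disk z -> weight alpha z * Cmod (C_derive phi z) <= K * weight alpha (phi z)) ->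
  in_disk z ->
  weight alpha z * Cmod (C_derive (iterate phi k) z) <= K ^ k * weight alpha (iterate phi k z).
Proof.
intros HK Hphi Hle Hz; induction k as [|k IH].
- replace (C_derive (iterate phi 0) z) with (RtoC 1).
  + rewrite Cmod_1; simpl; lra.
  + symmetry; apply is_C_derive_unique, is_derive_C_iff_AbsRing.
    apply (is_derive_id (K := C_AbsRing)).
- destruct (is_derive_iterate phi k z Hphi Hz) as [_ ->].
  rewrite Cmod_mult.
  specialize (Hle _ (iterate_in_disk phi k z Hphi Hz)).
  change (phi (iterate phi k z)) with (iterate phi (S k) z) in Hle.
  assert (H := Cmod_ge_0 (C_derive phi (iterate phi k z))).
  assert (HKk := pow_le K k HK).
  rewrite <- Rmult_assoc.
  eapply Rle_trans; [apply Rmult_le_compat_r; [exact H|exact IH]|].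
  rewrite Rmult_assoc.
  eapply Rle_trans; [apply Rmult_le_compat_l; [exact HKk|exact Hle]|].
  simpl; right; ring.
Qed.

(** The telescoping continues after the first $m$ steps with ratios at most $|\varphi'(0)|$. Keeping
    the weight of the last iterate on the right is what lets the induction proceed. *)
Lemma weight_C_derive_iterate_add_le (alpha K : R) (phi : C -> C) (m j : nat) (z : C) :
  0 <= K -> self_map_disk phi ->
  (forall z, in_disk z -> weight alpha z * Cmod (C_derive phi z) <= K * weight alpha (phi z)) ->
  (forall z, in_disk z ->
    weight alpha (iterate phi m z) * Cmod (C_derive phi (iterate phi m z))
      / weight alpha (iterate phi (m + 1) z) <= Cmod (C_derive phi (RtoC 0))) ->
  in_disk z ->
  weight alpha z * Cmod (C_derive (iterate phi (j + m)) z) <=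
    K ^ m * Cmod (C_derive phi (RtoC 0)) ^ j * weight alpha (iterate phi (j + m) z).
Proof.
intros HK Hphi Hle Hm Hz; induction j as [|j IH].
- simpl; rewrite Rmult_1_r; now apply weight_C_derive_iterate_le.
- change (S j + m)%nat with (S (j + m)).
  destruct (is_derive_iterate phi (j + m) z Hphi Hz) as [_ ->].
  rewrite Cmod_mult.
  (* Used at $\varphi_j(z)$, the hypothesis concerns $\varphi_m(\varphi_j(z)) = \varphi_{j+m}(z)$,
     the point of the new chain-rule factor. *)
  specialize (Hm _ (iterate_in_disk phi j z Hphi Hz)).
  rewrite <- !iterate_add in Hm.
  replace (m + j)%nat with (j + m)%nat in Hm by lia.
  replace (m + 1 + j)%nat with (S (j + m)) in Hm by lia.
  assert (Hw := weight_pos alpha (iterate phi (S (j + m)) z)).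
  apply (Rmult_le_compat_r (weight alpha (iterate phi (S (j + m)) z))) in Hm; [|lra].
  unfold Rdiv in Hm; rewrite (Rmult_assoc (_ * _)), Rinv_l, Rmult_1_r in Hm by lra.
  assert (H := Cmod_ge_0 (C_derive phi (iterate phi (j + m) z))).
  assert (HKk := pow_le K m HK).
  assert (Hlj := pow_le _ j (Cmod_ge_0 (C_derive phi (RtoC 0)))).
  rewrite <- Rmult_assoc.
  eapply Rle_trans; [apply Rmult_le_compat_r; [exact H|exact IH]|].
  rewrite Rmult_assoc.
  eapply Rle_trans; [apply Rmult_le_compat_l; [now apply Rmult_le_pos|exact Hm]|].
  simpl; right; ring.
Qed.

(** * Boundedness of Bloch functions for $\alpha < 1$ *)

Lemma weight_ge_Rpower (alpha r : R) (z : C) :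
  0 <= alpha -> Cmod z <= r < 1 -> Rpower (1 - r) alpha <= weight alpha z.
Proof.
intros Ha Hr; apply Rle_Rpower_l; [assumption|].
assert (H := Cmod_ge_0 z); nra.
Qed.

Lemma Bloch_bounded (alpha M : R) (f : C -> C) :
  0 < alpha < 1 -> holomorphic_on_disk f ->
  (forall z, in_disk z -> weight alpha z * Cmod (C_derive f z) <= M) ->
  forall z, in_disk z -> Cmod (f z) <= Cmod (f (RtoC 0)) + M / (1 - alpha).
Proof.
intros Hal Hf HM z Hz.
assert (HM0 : 0 <= M).
{ assert (H0 : in_disk (RtoC 0)) by (unfold in_disk; rewrite Cmod_0; lra).
  eapply Rle_trans; [|apply (HM _ H0)].
  apply Rmult_le_pos; [left; apply weight_pos|apply Cmod_ge_0]. }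
unfold in_disk in Hz; assert (Hz0 := Cmod_ge_0 z); set (r := Cmod z) in *.
assert (Hseg : forall t, 0 <= t <= 1 -> Cmod (RtoC 0 + RtoC t * z) <= t * r < 1).
{ intros t Ht; rewrite Cplus_0_l, Cmod_mult, Cmod_R, Rabs_pos_eq by lra.
  fold r; split; nra. }
(* The majorant is a primitive of $M r (1-tr)^{-\alpha}$, which dominates $r|f'(tz)|$. Its increment
   $\frac{M}{1-\alpha}(1-(1-r)^{1-\alpha})$ stays below $M/(1-\alpha)$ for all $r < 1$. *)
assert (H : Cmod (f (RtoC 0 + z)%C - f (RtoC 0))%C <=
  (fun t => - (M / (1 - alpha)) * Rpower (1 - t * r) (1 - alpha)) 1 -
  (fun t => - (M / (1 - alpha)) * Rpower (1 - t * r) (1 - alpha)) 0).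
{ apply (Cmod_mean_value f (RtoC 0) z
    (fun t => - (M / (1 - alpha)) * Rpower (1 - t * r) (1 - alpha))
    (fun t => M * r * Rpower (1 - t * r) (- alpha))).
  - intros t Ht; apply Hf; unfold in_disk; specialize (Hseg t Ht); lra.
  - intros t Ht; specialize (Hseg t Ht).
    replace (M * r * Rpower (1 - t * r) (- alpha)) with
      (- (M / (1 - alpha)) * ((1 - alpha) * Rpower (1 - t * r) (1 - alpha - 1) * (- r))).
    + apply derivable_pt_lim_scal.
      apply (derivable_pt_lim_comp (fun t => 1 - t * r) (fun x => Rpower x (1 - alpha))).
      * apply is_derive_Reals; auto_derive; [exact I|ring].
      * apply derivable_pt_lim_power; lra.
    + replace (1 - alpha - 1) with (- alpha) by ring. field; lra.
  - intros t Ht; specialize (Hseg t Ht). fold r.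
    set (y := (RtoC 0 + RtoC t * z)%C) in *.
    assert (Hy : in_disk y) by (unfold in_disk; lra).
    specialize (HM y Hy).
    assert (Hw : Rpower (1 - t * r) alpha <= weight alpha y)
      by (apply weight_ge_Rpower; lra).
    assert (Hp : 0 < Rpower (1 - t * r) alpha) by apply exp_pos.
    rewrite Rpower_Ropp, (Rmult_comm M), Rmult_assoc.
    apply Rmult_le_compat_l; [assumption|].
    apply (Rmult_le_reg_r (Rpower (1 - t * r) alpha)); [assumption|].
    rewrite Rmult_assoc, Rinv_l, Rmult_1_r by lra.
    assert (H := Cmod_ge_0 (C_derive f y)). nra. }
simpl in H.
rewrite Cplus_0_l, Rmult_0_l, Rmult_1_l, Rminus_0_r, Rpower_1_l in H.
assert (Hq : 0 <= M / (1 - alpha)) by (apply Rdiv_le_0_compat; lra).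
assert (Hp : 0 < Rpower (1 - r) (1 - alpha)) by apply exp_pos.
assert (HT := Cmod_triangle (f (RtoC 0)) (f z - f (RtoC 0))).
replace (f (RtoC 0) + (f z - f (RtoC 0)))%C with (f z) in HT by ring.
nra.
Qed.

(** * Derivative bounds for pointwise limits and the Königs function *)

Lemma Cmod_le_of_filterlim (u : nat -> C) (l : C) (L : R) (N : nat) :
  filterlim u eventually (locally l) -> (forall n, (N <= n)%nat -> Cmod (u n) <= L) ->
  Cmod l <= L.
Proof.
intros Hu HL.
apply (filterlim_le (F := eventually) (fun n => Cmod (u n)) (fun _ => L) (Cmod l) L).
- now exists N.
- eapply filterlim_comp; [exact Hu|].
  apply (filterlim_norm (K := C_AbsRing) (V := C_NormedModule) l).
- apply filterlim_const.
Qed.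

Lemma filterlim_C_minus (u v : nat -> C) (l k : C) :
  filterlim u eventually (locally l) -> filterlim v eventually (locally k) ->
  filterlim (fun n => u n - v n)%C eventually (locally (l - k)%C).
Proof.
intros Hu Hv.
apply (filterlim_comp_2 (H := locally (- k)%C) (F := eventually) (G := locally l)
  u (fun n => - v n)%C Cplus).
- exact Hu.
- eapply filterlim_comp; [exact Hv|].
  apply (filterlim_opp (K := C_AbsRing) (V := C_NormedModule) k).
- apply (filterlim_plus (K := C_AbsRing) (V := C_NormedModule) l (- k)%C).
Qed.

(* Lipschitz constants survive pointwise limits, so that neither a Cauchy estimate nor locally
   uniform convergence is needed. *)
Lemma C_derive_limit_le (g : nat -> C -> C) (f : C -> C) (N : nat) (z : C) (d L : R) :
  0 < d ->
  (forall k y, (N <= k)%nat -> Cmod (y - z) < d ->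
    ex_derive_C (g k) y /\ Cmod (C_derive (g k) y) <= L) ->
  (forall y, Cmod (y - z) < d -> filterlim (fun k => g k y) eventually (locally (f y))) ->
  ex_derive_C f z ->
  Cmod (C_derive f z) <= L.
Proof.
intros Hd Hg Hlim Hf.
apply (Cmod_derive_le_of_Lipschitz f z _ d); [assumption| |now apply is_derive_C_derive].
intros y Hy.
assert (Hz : Cmod (z - z) < d) by (unfold Cminus; rewrite Cplus_opp_r, Cmod_0; lra).
apply (Cmod_le_of_filterlim _ _ _ N (filterlim_C_minus _ _ _ _ (Hlim y Hy) (Hlim z Hz))).
intros k Hk.
set (v := (y - z)%C) in *; replace y with (z + v)%C by (unfold v; ring).
assert (Hseg : forall t, 0 <= t <= 1 -> Cmod (z + RtoC t * v - z) < d).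
{ intros t Ht; replace (z + RtoC t * v - z)%C with (RtoC t * v)%C by ring.
  rewrite Cmod_mult, Cmod_R, Rabs_pos_eq by lra.
  assert (H := Cmod_ge_0 v); nra. }
replace (L * Cmod v) with ((fun t => L * Cmod v * t) 1 - (fun t => L * Cmod v * t) 0) by ring.
apply (Cmod_mean_value (g k) z v _ (fun _ => L * Cmod v)).
- intros t Ht; now apply Hg, Hseg.
- intros t Ht; apply is_derive_Reals; auto_derive; [exact I|ring].
- intros t Ht; rewrite Rmult_comm; apply Rmult_le_compat_r; [apply Cmod_ge_0|].
  now apply Hg, Hseg.
Qed.

Lemma is_derive_C_div_const (f : C -> C) (z l c : C) :
  is_derive_C f z l ->
  is_derive_C (fun x => f x / c)%C z (l / c)%C.
Proof.
intros H; apply is_derive_C_iff_AbsRing in H.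
exact (is_derive_scal_l (K := C_AbsRing) (V := C_NormedModule) f z l (/ c)%C H).
Qed.

(** After division by $\varphi'(0)^k$ the bound on the iterates no longer depends on $k$. The factor
    $4^\alpha$ is the cost of comparing the weight at $z$ with the weight on a whole neighbourhood,
    where the derivatives must be bounded to pass to the limit. *)
Lemma weight_C_derive_Koenigs_le (alpha B : R) (phi sigma : C -> C) (m : nat) :
  0 < alpha -> self_map_disk phi -> 0 < Cmod (C_derive phi (RtoC 0)) -> is_Koenigs phi sigma ->
  0 <= B ->
  (forall k z, (m <= k)%nat -> in_disk z ->
    weight alpha z * Cmod (C_derive (iterate phi k) z) <= B * Cmod (C_derive phi (RtoC 0)) ^ k) ->
  forall z, in_disk z -> weight alpha z * Cmod (C_derive sigma z) <= Rpower 4 alpha * B.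
Proof.
intros Hal Hphi Hlam [Hsig Hlim] HB Hle z Hz.
set (lam := C_derive phi (RtoC 0)) in *.
assert (Hz' := Hz); unfold in_disk in Hz'; assert (Hz0 := Cmod_ge_0 z).
(* On the disk of radius [(1 - |z|)/2] about [z] the weight is at least [4^(-alpha)] times
   its value at [z]. *)
set (r := (1 + Cmod z) / 2).
assert (Hr : Cmod z < r < 1) by (unfold r; lra).
assert (Hp : 0 < Rpower (1 - r) alpha) by apply exp_pos.
assert (Hnear : forall y, Cmod (y - z) < r - Cmod z -> Cmod y <= r).
{ intros y Hy; replace y with ((y - z) + z)%C by ring.
  eapply Rle_trans; [apply Cmod_triangle|lra]. }
assert (HL : Cmod (C_derive sigma z) <= B / Rpower (1 - r) alpha).
{ apply (C_derive_limit_le (fun k y => iterate phi k y / Cpow lam k)%C sigma m z (r - Cmod z));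
    [lra| | |now apply Hsig].
  - intros k y Hk Hy; specialize (Hnear y Hy).
    assert (Hyd : in_disk y) by (unfold in_disk; lra).
    assert (Hlk : 0 < Cmod lam ^ k) by now apply pow_lt.
    assert (Hlk0 : Cpow lam k <> RtoC 0) by (apply Cmod_gt_0; now rewrite Cmod_pow).
    destruct (is_derive_iterate phi k y Hphi Hyd) as [Hex _].
    assert (Hd := is_derive_C_div_const _ _ _ (Cpow lam k) (is_derive_C_derive _ _ Hex)).
    split; [now exists (C_derive (iterate phi k) y / Cpow lam k)%C|].
    erewrite is_C_derive_unique by exact Hd; rewrite Cmod_div, Cmod_pow by assumption.
    specialize (Hle k y Hk Hyd).
    assert (Hw : Rpower (1 - r) alpha <= weight alpha y) by (apply weight_ge_Rpower; lra).
    assert (H := Cmod_ge_0 (C_derive (iterate phi k) y)).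
    apply (Rmult_le_reg_r (Cmod lam ^ k)); [assumption|].
    apply (Rmult_le_reg_l (Rpower (1 - r) alpha)); [assumption|].
    replace (Rpower (1 - r) alpha * (Cmod (C_derive (iterate phi k) y) / Cmod lam ^ k * Cmod lam ^ k))
      with (Rpower (1 - r) alpha * Cmod (C_derive (iterate phi k) y)) by (field; lra).
    replace (Rpower (1 - r) alpha * (B / Rpower (1 - r) alpha * Cmod lam ^ k))
      with (B * Cmod lam ^ k) by (field; lra).
    nra.
  - intros y Hy; apply Hlim; unfold in_disk; specialize (Hnear y Hy); lra. }
(* Here $1-|z|^2 \le 2(1-|z|) = 4(1-r)$. *)
assert (Hw : weight alpha z <= Rpower 4 alpha * Rpower (1 - r) alpha).
{ rewrite Rpower_mult_distr by lra.
  destruct (one_minus_Cmod_sq_bounds z Hz) as [H1 H2].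
  apply Rle_Rpower_l; [lra|]. unfold r; lra. }
eapply Rle_trans; [apply Rmult_le_compat; [left; apply weight_pos|apply Cmod_ge_0|exact Hw|exact HL]|].
right; field; lra.
Qed.

(** * Powers of Bloch functions and the conclusion *)

Lemma Bloch_pow (alpha : R) (f : C -> C) (n : nat) :
  0 < alpha < 1 -> Bloch alpha f -> Bloch alpha (fun z => Cpow (f z) (S n)).
Proof.
intros Hal [Hf [M HM]]; split.
- intros z Hz; eexists; now apply is_derive_C_pow, is_derive_C_derive, Hf.
- set (b := Cmod (f (RtoC 0)) + M / (1 - alpha)).
  exists (INR (S n) * b ^ n * M); intros z Hz.
  assert (HS : Cmod (f z) <= b) by now apply Bloch_bounded.
  erewrite is_C_derive_unique by exact (is_derive_C_pow f z _ n (is_derive_C_derive f z (Hf z Hz))).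
  rewrite !Cmod_mult, Cmod_pow, Cmod_R, Rabs_pos_eq by apply pos_INR.
  replace (weight alpha z * (INR (S n) * Cmod (f z) ^ n * Cmod (C_derive f z)))
    with (INR (S n) * Cmod (f z) ^ n * (weight alpha z * Cmod (C_derive f z))) by ring.
  apply Rmult_le_compat.
  + apply Rmult_le_pos; [apply pos_INR|apply pow_le, Cmod_ge_0].
  + apply Rmult_le_pos; [left; apply weight_pos|apply Cmod_ge_0].
  + apply Rmult_le_compat_l; [apply pos_INR|].
    apply pow_incr; split; [apply Cmod_ge_0|exact HS].
  + now apply HM.
Qed.

Theorem theorem3p1 (alpha : R) (phi sigma : C -> C)
  (Halpha : 0 < alpha < 1)
  (Hphi : self_map_disk phi)
  (Hphi0 : phi (RtoC 0) = RtoC 0)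
  (Hdphi0 : 0 < Cmod (C_derive phi (RtoC 0)) < 1)
  (Hsigma : is_Koenigs phi sigma)
  (Hbounded : comp_op_bounded alpha phi)
  (Hiter : exists m : nat, forall z : C, in_disk z ->
    weight alpha (iterate phi m z) * Cmod (C_derive phi (iterate phi m z))
      / weight alpha (iterate phi (m + 1) z)
    <= Cmod (C_derive phi (RtoC 0))) :
  forall n : nat, (1 <= n)%nat -> Bloch alpha (fun z : C => Cpow (sigma z) n).
Proof.
destruct Hiter as [m Hm].
destruct (comp_op_bounded_weight alpha phi Halpha Hphi Hbounded) as [K [HK HKle]].
assert (HB : Bloch alpha sigma).
{ split; [apply Hsigma|].
  set (lam := Cmod (C_derive phi (RtoC 0))) in *.
  assert (Hlm : 0 < lam ^ m) by (apply pow_lt; lra).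
  (* For $k = j + m$ the factor $K^m \lambda^j$ equals $(K^m/\lambda^m)\lambda^k$, and the weight of
     the last iterate is at most 1. *)
  exists (Rpower 4 alpha * (K ^ m / lam ^ m)).
  apply (weight_C_derive_Koenigs_le alpha (K ^ m / lam ^ m) phi sigma m);
    [lra|assumption|apply Hdphi0|assumption| |].
  { apply Rdiv_le_0_compat; [now apply pow_le|assumption]. }
  intros k z Hk Hz; replace k with ((k - m) + m)%nat by lia.
  fold lam; set (j := (k - m)%nat).
  eapply Rle_trans; [now apply (weight_C_derive_iterate_add_le alpha K)|].
  fold lam.
  replace (K ^ m / lam ^ m * lam ^ (j + m)) with (K ^ m * lam ^ j * 1)
    by (rewrite pow_add; field; lra).
  apply Rmult_le_compat_l.
  - apply Rmult_le_pos; apply pow_le; [assumption|lra].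
  - apply weight_le_1; [lra|now apply iterate_in_disk]. }
intros [|n] Hn; [lia|now apply Bloch_pow].
Qed.
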